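(* After a suitable rotation, the truncated tetrahedron in $\mathbb{R}^3$ can be decomposed into two heptahedra (convex polytopes with exactly 7 faces) with orthogonally connected boundaries.
   Context: A polygonal path in $\mathbb{R}^3$ is orthogonal if each of its edges is parallel to one of the coordinate axes. A set $S\subset\mathbb{R}^3$ is orthogonally connected if any two distinct points of $S$ are joined by an orthogonal path contained in $S$. A polytope is decomposed into polytopes $P_1,\dots,P_k$ if it is their union and their interiors are pairwise disjoint. Faces are the 2-dimensional faces. ''After a suitable rotation'' means that there is a rotation of $\mathbb{R}^3$ such that the image of the polytope has the stated property with respect to the fixed coordinate axes. The truncated tetrahedron is the Archimedean solid with 4 triangular and 4 regular hexagonal faces, obtained from a regular tetrahedron by cutting off its vertices at one third of the edge length. *)

(* Defs.v *)
From mathcomp Require Import all_boot all_order all_algebra.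
From mathcomp Require Import all_classical all_reals all_analysis.

Set Implicit Arguments.
Unset Strict Implicit.
Unset Printing Implicit Defensive.

Import Order.TTheory GRing.Theory Num.Theory.
Import numFieldNormedType.Exports.

Local Open Scope classical_set_scope.
Local Open Scope ring_scope.

(* The norm that the library puts on 'rV[R]_3 is the sup norm, hence the
   explicit Euclidean distance; the topology is the usual one. *)
Definition dot (R : realType) (x y : 'rV[R]_3) : R :=
  \sum_(k < 3) x 0 k * y 0 k.

Definition dist (R : realType) (x y : 'rV[R]_3) : R :=
  Num.sqrt (dot (x - y) (x - y)).

Definition convex_hull (R : realType) (A : set 'rV[R]_3) : set 'rV[R]_3 :=
  smallest (@convex_set R 'rV[R]_3) A.

Definition boundary (R : realType) (A : set 'rV[R]_3) : set 'rV[R]_3 :=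
  closure A `\` A°.

Definition affinely_independent (R : realType) (d : nat)
    (p : 'I_d.+1 -> 'rV[R]_3) : Prop :=
  row_free (\matrix_(i < d) (p (lift ord0 i) - p ord0)).

(* The affine hull of A has dimension d. *)
Definition has_dim (R : realType) (d : nat) (A : set 'rV[R]_3) : Prop :=
  (exists p : 'I_d.+1 -> 'rV[R]_3,
     (forall i, A (p i)) /\ affinely_independent p) /\
  ~ (exists p : 'I_d.+2 -> 'rV[R]_3,
     (forall i, A (p i)) /\ affinely_independent p).

(* Polytopes are required to be full-dimensional, as a solid in R^3 is. *)
Definition convex_polytope (R : realType) (P : set 'rV[R]_3) : Prop :=
  P° !=set0 /\
  exists V : set 'rV[R]_3, finite_set V /\ P = convex_hull V.

(* 2-dimensional intersections of P with a supporting plane u . x = c *)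
Definition face (R : realType) (P F : set 'rV[R]_3) : Prop :=
  has_dim 2 F /\
  exists (u : 'rV[R]_3) (c : R),
    [/\ u != 0, (forall x, P x -> dot u x <= c)
      & F = P `&` [set x | dot u x = c]].

Definition heptahedron (R : realType) (P : set 'rV[R]_3) : Prop :=
  convex_polytope P /\ ([set F | face P F] #= `I_7)%card.

Definition segment (R : realType) (p q : 'rV[R]_3) : set 'rV[R]_3 :=
  [set p + t *: (q - p) | t in `[0, 1]].

Definition axis_parallel (R : realType) (p q : 'rV[R]_3) : Prop :=
  exists (k : 'I_3) (t : R), t != 0 /\ q - p = t *: delta_mx 0 k.

(* x :: s lists the consecutive vertices of an orthogonal path inside S. *)
Fixpoint orthogonal_path (R : realType) (S : set 'rV[R]_3)
    (x : 'rV[R]_3) (s : seq 'rV[R]_3) : Prop :=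
  if s is y :: s' then
    [/\ axis_parallel x y, segment x y `<=` S & orthogonal_path S y s']
  else True.

Definition orthogonally_connected (R : realType) (S : set 'rV[R]_3) : Prop :=
  forall x y, S x -> S y -> x != y ->
    exists s : seq 'rV[R]_3, orthogonal_path S x s /\ last x s = y.

Definition decomposed (R : realType) (A : set 'rV[R]_3) (k : nat)
    (P : 'I_k -> set 'rV[R]_3) : Prop :=
  [/\ forall i, convex_polytope (P i),
      A = \bigcup_i P i
    & trivIset setT (fun i => (P i)°)].

Definition rotation (R : realType) (M : 'M[R]_3) : Prop :=
  M *m M^T = 1%:M /\ \det M = 1.

(* Four points of R^3 at the same positive distance from each other are
   automatically affinely independent. *)
Definition regular_tetrahedron (R : realType) (v : 'I_4 -> 'rV[R]_3) : Prop :=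
  exists a : R, 0 < a /\ forall i j, i != j -> dist (v i) (v j) = a.

(* The corner cut off at v i; the index j = i contributes the apex v i. *)
Definition corner (R : realType) (v : 'I_4 -> 'rV[R]_3) (i : 'I_4) :
    set 'rV[R]_3 :=
  convex_hull (range (fun j : 'I_4 => v i + 3%:R^-1 *: (v j - v i))).

(* The closure restores the triangular faces along which the cuts are made. *)
Definition truncated_tetrahedron (R : realType) (T : set 'rV[R]_3) : Prop :=
  exists v : 'I_4 -> 'rV[R]_3, regular_tetrahedron v /\
    T = closure (convex_hull (range v) `\` \bigcup_i corner v i).

(* Main.v *)
Require Import Defs.
From mathcomp Require Import all_boot all_order all_algebra.
From mathcomp Require Import all_classical all_reals all_analysis.
From mathcomp Require Import ring lra.
Import Order.TTheory GRing.Theory Num.Theory.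
Import numFieldNormedType.Exports.
Local Open Scope classical_set_scope.
Local Open Scope ring_scope.

(** Two opposite edges of a regular tetrahedron are orthogonal to each other
and to the line through their midpoints.  Rotate so that these three
directions are the axes: one edge becomes parallel to z, the opposite one to
y, and x runs between their midpoints.  A separate rescaling of each axis
changes neither convexity nor the notion of an axis-parallel segment, and
brings the vertices to (3, 0, 6), (3, 0, -6), (-3, 6, 0), (-3, -6, 0).  With
f(x) = min(3 + x, 5 - x), the truncated tetrahedron is then
  |z| <= f(x)  and  |y| <= f(-x)
(lemma [truncation_frame]): each section at constant x is a rectangle, and
each face is parallel to the y-axis or to the z-axis.

The plane y = 0 is a plane of symmetry.  It cuts the solid into the half
  |z| <= f(x)  and  0 <= y <= f(-x)
and its mirror image.  The half has seven faces: the cut, four faces that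
make up |z| = f(x), and two that make up y = f(-x).  Its boundary is
orthogonally connected ([orthogonally_connected_half_solid]): in the cut one
moves along z and then along x to the origin; a point with |z| = f(x) moves
along y down to the cut; a point with y = f(-x) moves along z until
|z| = f(x).

Three facts make this rigorous.  The faces of a polyhedron that is given by
inequalities are counted by [card_faces_hpoly], as soon as each inequality has
a point where it alone is an equality.  In barycentric coordinates the
truncation of a simplex at one third of its edges bounds each coordinate by
2/3 ([truncation_bary]), whatever the shape of the simplex.  The rotation and
the scales come from the Gram matrix of the edge vectors
([regular_tetrahedron_frame]).

The rescaling is not carried out on sets: all solids are described in a frame
with an origin and one nonzero scale per axis.  A scale may be negative, so
that the mirror half is the same solid in the frame with the y-scale negated,
and so that the rotation can be given determinant 1. *)

(** * The dot product *)

Section Dot.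
Context {R : realType}.
Implicit Types (u x y : 'rV[R]_3) (a : R).

Lemma dot_mulmx x y : dot x y = (x *m y^T) 0 0.
Proof. by rewrite mxE; apply: eq_bigr => k _; rewrite mxE. Qed.

Lemma dotC x y : dot x y = dot y x.
Proof. by apply: eq_bigr => k _; rewrite mulrC. Qed.

Lemma dotDr u x y : dot u (x + y) = dot u x + dot u y.
Proof. by rewrite !dot_mulmx linearD mulmxDr mxE. Qed.

Lemma dotZr u a x : dot u (a *: x) = a * dot u x.
Proof. by rewrite !dot_mulmx linearZ -scalemxAr mxE. Qed.

Lemma dotNr u x : dot u (- x) = - dot u x.
Proof. by rewrite -scaleN1r dotZr mulN1r. Qed.

Lemma dotBr u x y : dot u (x - y) = dot u x - dot u y.
Proof. by rewrite dotDr dotNr. Qed.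

Lemma dotDl u x y : dot (x + y) u = dot x u + dot y u.
Proof. by rewrite !(dotC _ u) dotDr. Qed.

Lemma dotNl u x : dot (- x) u = - dot x u.
Proof. by rewrite !(dotC _ u) dotNr. Qed.

Lemma dotZl u a x : dot (a *: u) x = a * dot u x.
Proof. by rewrite !(dotC _ x) dotZr. Qed.

Lemma dot_gt0 u : u != 0 -> 0 < dot u u.
Proof.
move=> u0; rewrite lt_neqAle sumr_ge0 ?andbT.
  apply: contra u0; rewrite eq_sym psumr_eq0 => [/allP uu|k _].
    apply/eqP/rowP => k; rewrite mxE; apply/eqP.
    by have := uu k (mem_index_enum k); rewrite mulf_eq0 orbb.
  by rewrite -expr2 sqr_ge0.
by move=> k _; rewrite -expr2 sqr_ge0.
Qed.

Lemma dotE x y :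
  dot x y = x 0 0 * y 0 0 + x 0 1 * y 0 1 + x 0 2 * y 0 2.
Proof.
rewrite /dot !big_ord_recl big_ord0 addr0 addrA.
by congr (_ + _ * _ + _ * _); congr (_ 0 _); apply: val_inj.
Qed.

Lemma dot_continuous u : continuous (dot u).
Proof.
have cu k : continuous (fun x : 'rV[R]_3 => u 0 k * x 0 k).
  move=> x; apply: continuous_comp; first exact: coord_continuous.
  exact: mulrl_continuous.
have -> : dot u = (fun x => u 0 0 * x 0 0) \+
    ((fun x => u 0 1 * x 0 1) \+ (fun x => u 0 2 * x 0 2)).
  by apply/funext => x; rewrite dotE -addrA.
by move=> x; do 2?[apply: continuousD; first exact: cu]; exact: cu.
Qed.

End Dot.

(** * Convex sets *)

Section Convex.
Context {R : realType}.
Implicit Types (A C : set 'rV[R]_3).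

Lemma convex_setP C : convex_set C <->
  forall x y t, 0 <= t <= 1 -> C x -> C y -> C ((1 - t) *: x + t *: y).
Proof.
split=> [cC x y t /andP[t0 t1] Cx Cy|cC x y t /set_mem Cx /set_mem Cy].
  have := cC y x (Itv01 t0 t1) (mem_set Cy) (mem_set Cx).
  by rewrite inE addrC.
apply/mem_set; have := cC y x t%:num; rewrite addrC.
by apply => //; rewrite ge0 le1.
Qed.

(** Induction on the number of points: all but the first one are merged into
their own barycentre, with the remaining weight [s]. *)
Lemma convex_sum C n (p : 'I_n -> 'rV[R]_3) (l : 'I_n -> R) :
  convex_set C -> (forall i, C (p i)) -> (forall i, 0 <= l i) ->
  \sum_i l i = 1 -> C (\sum_i l i *: p i).
Proof.
move=> /convex_setP cC; elim: n => [|n IHn] in p l *.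
  by move=> _ _; rewrite big_ord0 => /eqP; rewrite eq_sym oner_eq0.
move=> Cp l0; rewrite !big_ord_recl.
set s := \sum_(i < n) _ => ls.
have s0 : 0 <= s by apply: sumr_ge0.
have [s_eq0|sN0] := eqVneq s 0.
  rewrite big1 ?addr0 => [|i _].
    by move: ls; rewrite s_eq0 addr0 => ->; rewrite scale1r.
  by have /psumr_eq0P -> // := s_eq0; rewrite scale0r.
have -> : l ord0 = 1 - s by rewrite -ls addrK.
have -> : \sum_(i < n) l (lift ord0 i) *: p (lift ord0 i) =
    s *: \sum_(i < n) (s^-1 * l (lift ord0 i)) *: p (lift ord0 i).
  rewrite scaler_sumr; apply: eq_bigr => i _.
  by rewrite scalerA mulrA divff// mul1r.
apply: cC => //; first by rewrite s0 -ls lerDr l0.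
apply: IHn => // [i|]; first by rewrite mulr_ge0 ?invr_ge0.
by rewrite -mulr_sumr mulVf.
Qed.

Lemma convex_hull_convex A : convex_set (convex_hull A).
Proof.
apply/convex_setP => x y t t01 hx hy C [cC AC].
by have /convex_setP := cC; apply => //; [exact: hx|exact: hy].
Qed.

Lemma sub_convex_hull A : A `<=` convex_hull A.
Proof. exact: sub_gen_smallest. Qed.

Lemma convex_hull_min A C : convex_set C -> A `<=` C -> convex_hull A `<=` C.
Proof. exact: smallest_sub. Qed.

End Convex.

(** * Affine independence in planes *)

Section AffineIndependence.
Context {R : realType}.
Implicit Types (u n : 'rV[R]_3) (c : R).

(** The normal of a plane through all the points is a kernel vector of the
matrix that defines affine independence, so dimension questions about planes
become rank computations. *)
Lemma diff_ortho d (p : 'I_d.+1 -> 'rV[R]_3) u c :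
  (forall i, dot u (p i) = c) ->
  u *m (\matrix_(i < d) (p (lift ord0 i) - p ord0))^T = 0.
Proof.
move=> up; apply/rowP => i; rewrite !mxE.
transitivity (dot u (p (lift ord0 i) - p ord0)); last
  by rewrite dotBr !up subrr.
by apply: eq_bigr => k _; rewrite !mxE.
Qed.

Lemma plane_dim_le2 (p : 'I_4 -> 'rV[R]_3) u c :
  u != 0 -> (forall i, dot u (p i) = c) -> ~ affinely_independent p.
Proof.
move=> u0 up; rewrite /affinely_independent row_free_unit -unitmx_tr => Du.
by case/eqP: u0; rewrite -(mulmxK Du u) (diff_ortho _ _ _ _ up) mul0mx.
Qed.

(** Two independent directions in space have a one-dimensional orthogonal
space, which contains both normals. *)
Lemma plane_unique (p : 'I_3 -> 'rV[R]_3) u c n d :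
    affinely_independent p -> u != 0 -> n != 0 ->
    (forall i, dot u (p i) = c) -> (forall i, dot n (p i) = d) ->
  exists l, [/\ l != 0, n = l *: u & d = l * c].
Proof.
move=> ip u0 n0 up np.
suff [l nE] : exists l, n = l *: u.
  exists l; split => //; first by apply: contra n0 => /eqP l0;
    rewrite nE l0 scale0r.
  by rewrite -(np ord0) nE dotZl up.
have /sub_kermxP uK := diff_ortho _ _ _ _ up.
have /sub_kermxP nK := diff_ortho _ _ _ _ np.
apply/sub_rVP; apply: submx_trans nK _.
rewrite -(geq_leqif (mxrank_leqif_sup uK)) mxrank_ker mxrank_tr.
by rewrite (eqP ip) rank_rV u0.
Qed.

Lemma plane_directions u : u != 0 ->
  exists D : 'M[R]_(2, 3), row_free D /\ forall i, dot u (row i D) = 0.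
Proof.
move=> u0; set K := kermx u^T.
have rK : \rank K = 2 by rewrite mxrank_ker mxrank_tr rank_rV u0.
have : exists D : 'M[R]_(\rank K, 3), row_free D /\ forall i, dot u (row i D) =
  0.
  exists (row_base K); rewrite row_base_free; split=> // i.
  rewrite dotC dot_mulmx; suff /sub_kermxP -> : (row i (row_base K) <= K)%MS
    by rewrite mxE.
  by rewrite (submx_trans (row_sub _ _))// eq_row_base.
by rewrite rK.
Qed.

End AffineIndependence.

(** * Polyhedra and their facets *)

Section Halfspaces.
Context {R : realType}.
Implicit Types (A : set 'rV[R]_3) (x u : 'rV[R]_3).

(** A single step length serves finitely many directions.  The bound [e < 1]
lets the step be used as a convex combination as well. *)
Lemma interior_along A x m (w : 'I_m -> 'rV[R]_3) :
  A° x -> exists2 e : R, 0 < e < 1 & forall k, A (x + e *: w k).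
Proof.
move=> Ax.
have : \forall e \near (0 : R), forall k, A (x + e *: w k).
  apply: (@filter_forall _ _ _ (nbhs (0 : R))) => k.
  have : (x + e *: w k) @[e --> (0 : R)] --> x + 0 *: w k.
    by apply: cvgD; [exact: cvg_cst|apply: cvgZr_tmp].
  by rewrite scale0r addr0; apply.
move=> /nbhs_ballP[e /= e0 eA]; have e1 : 0 < 1 + e by rewrite addr_gt0.
exists (e / (1 + e)); first by rewrite divr_gt0// ltr_pdivrMr// mul1r
  ltrDr ltr01.
apply: eA; rewrite -ball_normE /= sub0r normrN gtr0_norm ?divr_gt0//.
by rewrite ltr_pdivrMr// ltr_pMr// ltrDl.
Qed.

(** A supporting plane cannot touch an interior point: a step along the normal
[u] would leave the half-space. *)
Lemma interior_halfspace A u c x :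
  u != 0 -> (forall y, A y -> dot u y <= c) -> A° x -> dot u x < c.
Proof.
move=> u0 Ac /(interior_along _ _ 1 (fun=> u))[e /andP[e0 _] /(_ 0)/Ac].
rewrite dotDr dotZr; apply: lt_le_trans.
by rewrite ltrDl mulr_gt0// dot_gt0.
Qed.

Definition hpoly {n} (a : 'I_n -> 'rV[R]_3) (c : 'I_n -> R) : set 'rV[R]_3 :=
  [set x | forall i, dot (a i) x <= c i].

Lemma hpoly_convex {n} (a : 'I_n -> 'rV[R]_3) c : convex_set (hpoly a c).
Proof.
apply/convex_setP => x y t /andP[t0 t1] hx hy i.
rewrite dotDr !dotZr; have := hx i; have := hy i; nra.
Qed.

Lemma closed_hpoly {n} (a : 'I_n -> 'rV[R]_3) c : closed (hpoly a c).
Proof.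
have -> : hpoly a c = \bigcap_i (dot (a i) @^-1` [set y | y <= c i]).
  by apply/seteqP; split=> [x h i _|x h i]; [exact: h|exact: (h i)].
by apply: closed_bigI => i _; apply: preimage_closed => // y _;
  exact: dot_continuous.
Qed.

Lemma hpoly_strict_interior {n} (a : 'I_n -> 'rV[R]_3) c x :
  (forall i, dot (a i) x < c i) -> (hpoly a c)° x.
Proof.
move=> h; apply: (@filter_forall _ _ _ (nbhs x)) => i.
have /(_ (nbhs_filter x)) := cvgr_lt _ (dot_continuous (a i) x) _ (h i).
by apply: (@filterS _ (nbhs x) _) => y /ltW.
Qed.

Lemma boundary_hpoly {n} (a : 'I_n -> 'rV[R]_3) c : (forall i, a i != 0) ->
  boundary (hpoly a c) = hpoly a c `&` [set x | exists i, dot (a i) x = c i].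
Proof.
move=> a0; rewrite /boundary -(closure_id _).1; last exact: closed_hpoly.
apply/seteqP; split=> x [hx xN]; split=> //.
  apply: contrapT => noact; apply/xN/hpoly_strict_interior => i.
  by rewrite lt_neqAle hx andbT; apply/eqP => ai; apply: noact; exists i.
have [i ai] := xN; move=> /(interior_halfspace _ (a i) (c i)) => /(_ (a0 i)).
by rewrite ai ltxx => /(_ (fun y h => h i)).
Qed.

Definition facet {n} (a : 'I_n -> 'rV[R]_3) (c : 'I_n -> R) i : set 'rV[R]_3 :=
  hpoly a c `&` [set x | dot (a i) x = c i].

(** The point [q i] lies on the [i]-th plane and strictly inside all the other
half-spaces.  It shows that the [i]-th inequality cuts out a two-dimensional
piece, and that no other inequality cuts out the same one. *)
Section Irredundant.
Variables (n : nat) (a : 'I_n -> 'rV[R]_3) (c : 'I_n -> R).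
Variable q : 'I_n -> 'rV[R]_3.
Hypothesis a_neq0 : forall i, a i != 0.
Hypothesis q_act : forall i, dot (a i) (q i) = c i.
Hypothesis q_strict : forall i j, j != i -> dot (a j) (q i) < c j.

Lemma facet_face i : face (hpoly a c) (facet a c i).
Proof.
split; last by exists (a i), (c i); split=> // x; exact.
split; last first.
  move=> [p [pF]]; apply: (plane_dim_le2 _ (a i) (c i)) => // k.
  by have [] := pF k.
have [D [Dfree Di]] := plane_directions _ (a_neq0 i).
(* Relaxing the i-th bound makes q i an interior point, hence leaves room for
   a step from q i in two independent directions of the i-th plane. *)
have q_int : (hpoly a (fun j => if j == i then c i + 1 else c j))° (q i).
  apply: hpoly_strict_interior => j; case: eqP => [->|/eqP];
    last exact: q_strict.
  by rewrite q_act ltrDl.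
have [e /andP[e0 _] eq] := interior_along _ _ _ (fun k => row k D) q_int.
exists (fun k => if unlift ord0 k is Some l then q i + e *: row l D else q i).
split=> [k|].
  have qF w : dot (a i) w = 0 ->
      hpoly a (fun j => if j == i then c i + 1 else c j) (q i + w) ->
      facet a c i (q i + w).
    move=> w0 hw; have act : dot (a i) (q i + w) = c i
      by rewrite dotDr q_act w0 addr0.
    split=> // j; have := hw j; case: eqP => // -> _.
    by rewrite act.
  case: unliftP => [l|] _; first by apply: qF => //; rewrite dotZr Di mulr0.
  rewrite -[q i]addr0; apply: qF; first by rewrite -(scale0r 0) dotZr mul0r.
  by rewrite addr0; exact: interior_subset.
rewrite /affinely_independent.
rewrite (_ : \matrix_(l < 2) _ = e *: D).
  by rewrite /row_free eqmx_scale// gt_eqF.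
by apply/matrixP => l k; rewrite mxE liftK unlift_none !mxE; ring.
Qed.

(** The centroid [m] of three affinely independent points of the face lies on
a supporting plane, hence is not interior, hence some inequality is an equality
at [m].  An average attains a common upper bound only if all its terms do, so
the three points lie on the plane of that inequality; three such points
determine a plane, which is therefore the supporting one. *)
Lemma face_facet F : face (hpoly a c) F -> exists i, F = facet a c i.
Proof.
move=> [[[p [pF p_indep]] _] [u [d [u0 hu FE]]]].
pose m := 3^-1 *: (p 0 + p 1 + p 2).
have dot_m w : dot w m = 3^-1 * (dot w (p 0) + dot w (p 1) + dot w (p 2)).
  by rewrite dotZr !dotDr.
have up k : dot u (p k) = d by have := pF k; rewrite FE => -[].
have um : dot u m = d by rewrite dot_m !up; field.
have pP k : hpoly a c (p k) by have := pF k; rewrite FE => -[].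
have [i im] : exists i, dot (a i) m = c i.
  apply: contrapT => noact.
  suff /(interior_halfspace _ _ _ _ u0 hu) : (hpoly a c)° m by rewrite um ltxx.
  apply: hpoly_strict_interior => i; rewrite lt_neqAle; apply/andP; split.
    by apply/eqP => im; apply: noact; exists i.
  by rewrite dot_m; have := pP 0 i; have := pP 1 i; have := pP 2 i; lra.
have ip k : dot (a i) (p k) = c i.
  have := pP 0 i; have := pP 1 i; have := pP 2 i; move: im; rewrite dot_m.
  case: k => -[|[|[|//]]] k3.
  - by rewrite (_ : Ordinal k3 = 0); [lra|apply: val_inj].
  - by rewrite (_ : Ordinal k3 = 1); [lra|apply: val_inj].
  - by rewrite (_ : Ordinal k3 = 2); [lra|apply: val_inj].
have [l [l0 aE cE]] := plane_unique _ _ _ _ _ p_indep u0 (a_neq0 i) up ip.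
exists i; rewrite FE /facet; congr (_ `&` _); apply/seteqP; split=> x /=.
  by rewrite aE cE dotZl => ->.
by rewrite aE cE dotZl => /(mulfI l0).
Qed.

Lemma card_faces_hpoly : ([set F | face (hpoly a c) F] #= `I_n)%card.
Proof.
have -> : [set F | face (hpoly a c) F] = range (facet a c).
  apply/seteqP; split=> F /=; first by move=> /face_facet[i ->]; exists i.
  by move=> [i _ <-]; exact: facet_face.
rewrite (card_eqr card_II); apply: inj_card_eq => i j _ _ ij.
apply/eqP/negP => /negP ne.
have qi : facet a c i (q i).
  split=> [k|]; last exact: q_act.
  by have [->|/q_strict/ltW//] := eqVneq k i; rewrite q_act.
move: qi; rewrite ij => -[_ /= qj].
by have := q_strict i j; rewrite eq_sym ne qj ltxx => /(_ isT).
Qed.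

End Irredundant.
End Halfspaces.

(** * Orthogonal paths *)

Section Paths.
Context {R : realType}.
Implicit Types (S : set 'rV[R]_3) (x y z : 'rV[R]_3).

Definition joined S x y := exists s, orthogonal_path S x s /\ last x s = y.

Lemma joined_refl S x : joined S x x.
Proof. by exists [::]. Qed.

Lemma joined_trans S x y z : joined S x y -> joined S y z -> joined S x z.
Proof.
move=> [s [xs <-]] [t [yt <-]]; exists (s ++ t); rewrite last_cat; split=> //.
elim: s x xs yt => [//|w s IHs] x /= [xw wS ws] yt; split=> //.
exact: IHs.
Qed.

Lemma segmentC x y : segment x y = segment y x.
Proof.
have sub u v : segment u v `<=` segment v u.
  move=> _ [t t01 <-]; exists (1 - t).
    by move: t01; rewrite /= !in_itv /= => /andP[t0 t1]; apply/andP; split; lra.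
  by apply/rowP => k; rewrite !mxE; ring.
by apply/seteqP; split; exact: sub.
Qed.

Lemma axis_parallelC x y : axis_parallel x y -> axis_parallel y x.
Proof.
move=> [k [t [t0 yx]]]; exists k, (- t); rewrite oppr_eq0 t0; split=> //.
by rewrite scaleNr -yx opprB.
Qed.

Lemma joined_edge S x y :
  axis_parallel x y -> segment x y `<=` S -> joined S x y.
Proof. by move=> xy xyS; exists [:: y]. Qed.

Lemma joined_sym S x y : joined S x y -> joined S y x.
Proof.
move=> [s [xs <-]]; elim: s x xs => [|w s IHs] x /=; first by move=> _;
  exact: joined_refl.
move=> [xw wS ws]; apply: joined_trans (IHs _ ws) _.
by apply: joined_edge; [exact: axis_parallelC|rewrite segmentC].
Qed.

(** Since being joined is an equivalence relation, it is enough to reach one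
base point. *)
Lemma orthogonally_connected_star S o :
  (forall x, S x -> joined S x o) -> orthogonally_connected S.
Proof.
by move=> So x y Sx Sy _; apply: joined_trans (So x Sx) _; apply/joined_sym/So.
Qed.

End Paths.

(** * Solids in a scaled frame *)

Section Frame.
Context {R : realType}.

Definition row3 (x y z : R) : 'rV[R]_3 := \row_(k < 3) [:: x; y; z]`_k.

Lemma row3_eq (v : 'rV[R]_3) : row3 (v 0 0) (v 0 1) (v 0 2) = v.
Proof.
by apply/rowP => -[[|[|[|//]]] k3]; rewrite mxE /=; congr (v 0 _);
  apply: val_inj.
Qed.

(** The point with coordinates [x], [y], [z] when the origin is [g] and the
unit on the [k]-th axis has signed length [s 0 k]. *)
Definition frame (g s : 'rV[R]_3) (x y z : R) : 'rV[R]_3 :=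
  g + row3 (s 0 0 * x) (s 0 1 * y) (s 0 2 * z).

Variables (g s : 'rV[R]_3).
Hypothesis s_neq0 : forall k, s 0 k != 0.

Local Notation pt := (frame g s).

Lemma frame_surj p : exists x y z, p = pt x y z.
Proof.
exists ((p - g) 0 0 / s 0 0), ((p - g) 0 1 / s 0 1), ((p - g) 0 2 / s 0 2).
by rewrite /frame ![_ * (_ / _)]mulrC !divfK// row3_eq addrC subrK.
Qed.

Lemma frame_conv t x y z x' y' z' :
  (1 - t) *: pt x y z + t *: pt x' y' z' =
  pt ((1 - t) * x + t * x') ((1 - t) * y + t * y') ((1 - t) * z + t * z').
Proof.
by apply/rowP => -[[|[|[|//]]] k3]; rewrite !mxE /=; ring.
Qed.

(** The degenerate displacement [d = 0] is covered by the empty path, because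
an edge of an orthogonal path has positive length. *)
Lemma joined_axis (S : set 'rV[R]_3) p k d :
  (forall t, 0 <= t <= 1 -> S (p + (t * d) *: delta_mx 0 k)) ->
  joined S p (p + d *: delta_mx 0 k).
Proof.
move=> pS; have [->|d0] := eqVneq d 0; first by rewrite scale0r addr0;
  exact: joined_refl.
apply: joined_edge; first by exists k, d; rewrite addrC addKr.
move=> _ [t t01 <-]; rewrite [p + _ - p]addrC addKr scalerA; apply: pS.
by move: t01; rewrite /= in_itv.
Qed.

Lemma frame_x x y z d : pt x y z + (s 0 0 * d) *: delta_mx 0 0 = pt (x + d) y z.
Proof. by apply/rowP => -[[|[|[|//]]] k3]; rewrite !mxE /=; ring. Qed.

Lemma frame_y x y z d : pt x y z + (s 0 1 * d) *: delta_mx 0 1 = pt x (y + d) z.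
Proof. by apply/rowP => -[[|[|[|//]]] k3]; rewrite !mxE /=; ring. Qed.

Lemma frame_z x y z d : pt x y z + (s 0 2 * d) *: delta_mx 0 2 = pt x y (z + d).
Proof. by apply/rowP => -[[|[|[|//]]] k3]; rewrite !mxE /=; ring. Qed.

Lemma joined_x S x x' y z :
  (forall t, 0 <= t <= 1 -> S (pt (x + t * (x' - x)) y z)) ->
  joined S (pt x y z) (pt x' y z).
Proof.
move=> xS; rewrite -[x'](subrK x) [x' - x + x]addrC -frame_x.
by apply: joined_axis => t t01; rewrite mulrCA frame_x; exact: xS.
Qed.

Lemma joined_y S x y y' z :
  (forall t, 0 <= t <= 1 -> S (pt x (y + t * (y' - y)) z)) ->
  joined S (pt x y z) (pt x y' z).
Proof.
move=> yS; rewrite -[y'](subrK y) [y' - y + y]addrC -frame_y.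
by apply: joined_axis => t t01; rewrite mulrCA frame_y; exact: yS.
Qed.

Lemma joined_z S x y z z' :
  (forall t, 0 <= t <= 1 -> S (pt x y (z + t * (z' - z)))) ->
  joined S (pt x y z) (pt x y z').
Proof.
move=> zS; rewrite -[z'](subrK z) [z' - z + z]addrC -frame_z.
by apply: joined_axis => t t01; rewrite mulrCA frame_z; exact: zS.
Qed.

(** In frame coordinates this is the normal of the planes on which
[a * x + b * y + c * z] is constant. *)
Definition covector (a b c : R) : 'rV[R]_3 :=
  row3 (a / s 0 0) (b / s 0 1) (c / s 0 2).

Lemma dot_covector a b c x y z :
  dot (covector a b c) (pt x y z) =
  dot (covector a b c) g + (a * x + b * y + c * z).
Proof.
by rewrite dotDr; congr (_ + _); rewrite dotE !mxE /=; field; rewrite !s_neq0.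
Qed.

(** The entry [(a, b, c, d)] stands for [a * x + b * y + c * z <= d].  In this
order: the cut [0 <= y]; then [y <= f(-x)], that is [y <= 3 - x] and
[y <= 5 + x]; then [z <= f(x)] and [- z <= f(x)], each as two inequalities. *)
Definition half_ineq (i : nat) : R * R * R * R :=
  nth (0, 0, 0, 0)
    [:: (0, -1, 0, 0); (1, 1, 0, 3); (-1, 1, 0, 5);
        (-1, 0, 1, 3); (1, 0, 1, 5); (-1, 0, -1, 3); (1, 0, -1, 5)] i.

Definition half_normal (i : 'I_7) : 'rV[R]_3 :=
  let: (a, b, c, _) := half_ineq i in covector a b c.

Definition half_bound (i : 'I_7) : R :=
  (half_ineq i).2 + dot (half_normal i) g.

Definition half_solid : set 'rV[R]_3 := hpoly half_normal half_bound.

Lemma half_slack (i : 'I_7) x y z :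
  half_bound i - dot (half_normal i) (pt x y z) =
  let: (a, b, c, d) := half_ineq i in d - (a * x + b * y + c * z).
Proof.
rewrite /half_bound /half_normal; case: (half_ineq i) => [[[a b] c] d] /=.
by rewrite dot_covector opprD addrA addrK.
Qed.

Lemma half_leP (i : 'I_7) x y z :
  (dot (half_normal i) (pt x y z) <= half_bound i) =
  let: (a, b, c, d) := half_ineq i in (a * x + b * y + c * z <= d).
Proof. by rewrite -subr_ge0 half_slack; case: half_ineq => [[[a b] c] d];
  rewrite subr_ge0. Qed.

Lemma half_ltP (i : 'I_7) x y z :
  (dot (half_normal i) (pt x y z) < half_bound i) =
  let: (a, b, c, d) := half_ineq i in (a * x + b * y + c * z < d).
Proof. by rewrite -subr_gt0 half_slack; case: half_ineq => [[[a b] c] d];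
  rewrite subr_gt0. Qed.

Lemma half_eqP (i : 'I_7) x y z :
  dot (half_normal i) (pt x y z) = half_bound i <->
  let: (a, b, c, d) := half_ineq i in a * x + b * y + c * z = d.
Proof.
have := half_slack i x y z; case: half_ineq => [[[a b] c] d] sl.
split=> [e|e]; last by apply/eqP; rewrite eq_sym -subr_eq0 sl e subrr.
by apply/eqP; rewrite eq_sym -subr_eq0 -sl e subrr.
Qed.

Lemma half_normal_neq0 i : half_normal i != 0.
Proof.
apply/eqP => n0; have := half_slack i.
rewrite /half_bound n0 => sl.
have := sl 1 0 0; have := sl 0 1 0; have := sl 0 0 0;
  rewrite !(dotC 0) -(scale0r 0) !dotZr.
by case: i {n0 sl} => [[|[|[|[|[|[|[|//]]]]]]] i7] /=; rewrite /half_ineq /=;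
  lra.
Qed.

Lemma half_solid_frame x y z : half_solid (pt x y z) <->
  [/\ 0 <= y, y <= 3 - x, y <= 5 + x & `|z| <= 3 + x /\ `|z| <= 5 - x].
Proof.
rewrite !ler_norml; split=> [h|[h0 h1 h2 [/andP[h3 h4] /andP[h5 h6]]] i].
  have hi k (k7 : (k < 7)%N) := h (Ordinal k7).
  have := hi 0 isT; have := hi 1 isT; have := hi 2 isT; have := hi 3 isT.
  have := hi 4 isT; have := hi 5 isT; have := hi 6 isT.
  rewrite !half_leP /half_ineq /= => h6 h5 h4 h3 h2 h1 h0.
  by split; [lra..|split; apply/andP; split; lra].
rewrite half_leP.
by case: i => [[|[|[|[|[|[|[|//]]]]]]] i7]; rewrite /half_ineq /=; lra.
Qed.

Lemma boundary_half_solid_frame x y z : boundary half_solid (pt x y z) <->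
  [/\ 0 <= y, y <= 3 - x, y <= 5 + x, `|z| <= 3 + x /\ `|z| <= 5 - x &
     [\/ y = 0, y = 3 - x \/ y = 5 + x, `|z| = 3 + x | `|z| = 5 - x]].
Proof.
rewrite (boundary_hpoly half_normal half_bound half_normal_neq0).
split=> [[/half_solid_frame[h0 h1 h2 h34] [i /half_eqP ie]]|[h0 h1 h2 [h3 h4]
  act]].
  split=> //; case: h34 => [h3 h4]; move: h3 h4; rewrite !ler_norml =>
    /andP[z1 z2] /andP[z3 z4].
  case: i ie => [[|[|[|[|[|[|[|//]]]]]]] i7]; rewrite /half_ineq /= => e.
  - by constructor 1; lra.
  - by constructor 2; left; lra.
  - by constructor 2; right; lra.
  - by constructor 3; rewrite ger0_norm; lra.
  - by constructor 4; rewrite ger0_norm; lra.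
  - by constructor 3; rewrite ler0_norm; lra.
  - by constructor 4; rewrite ler0_norm; lra.
split; first by apply/half_solid_frame; split.
suff [k [k7 e]] : exists k (k7 : (k < 7)%N),
    let: (a, b, c, d) := half_ineq k in a * x + b * y + c * z = d.
  by exists (Ordinal k7); apply/half_eqP.
case: act => [e|[e|e]|e|e].
- by exists 0, isT; rewrite /half_ineq /=; lra.
- by exists 1, isT; rewrite /half_ineq /=; lra.
- by exists 2, isT; rewrite /half_ineq /=; lra.
- have [z0|z0] := leP 0 z.
    by exists 3, isT; rewrite /half_ineq /=; move: e; rewrite ger0_norm//; lra.
  by exists 5, isT; rewrite /half_ineq /=; move: e; rewrite ltr0_norm//; lra.
- have [z0|z0] := leP 0 z.
    by exists 4, isT; rewrite /half_ineq /=; move: e; rewrite ger0_norm//; lra.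
  by exists 6, isT; rewrite /half_ineq /=; move: e; rewrite ltr0_norm//; lra.
Qed.

(** Each face is parallel to an axis, and the cut [y = 0] to two of them.
Following these directions, a path from any point of the boundary reaches
first a face parallel to y, then the cut, then the origin. *)
Lemma orthogonally_connected_half_solid :
  orthogonally_connected (boundary half_solid).
Proof.
apply: (orthogonally_connected_star _ (pt 0 0 0)) => p.
have [x [y [z ->]]] := frame_surj p.
have base x0 z0 : boundary half_solid (pt x0 0 z0) ->
  joined (boundary half_solid) (pt x0 0 z0) (pt 0 0 0).
  move=> /boundary_half_solid_frame[_ h1 h2 [h3 h4] _].
  apply: (joined_trans _ _ (pt x0 0 0)).
    apply: joined_z => t /andP[t0 t1]; apply/boundary_half_solid_frame.
    rewrite (_ : z0 + _ = (1 - t) * z0); last by ring.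
    have zz : `|(1 - t) * z0| <= `|z0|.
      by rewrite normrM ler_piMl// ger0_norm; lra.
    by split; [lra..|split; lra|constructor 1].
  apply: joined_x => t /andP[t0 t1]; apply/boundary_half_solid_frame.
  have zz := normr_ge0 z0.
  rewrite normr0; split; [lra|nra|nra|split; nra|by constructor 1].
have side x0 y0 z0 : boundary half_solid (pt x0 y0 z0) ->
  `|z0| = 3 + x0 \/ `|z0| = 5 - x0 ->
    joined (boundary half_solid) (pt x0 y0 z0) (pt 0 0 0).
  move=> /boundary_half_solid_frame[h0 h1 h2 [h3 h4] _] e.
  have down t : 0 <= t <= 1 -> boundary half_solid (pt x0 (y0 + t * (0 - y0))
    z0).
    move=> /andP[t0 t1]; apply/boundary_half_solid_frame; split; [nra..|by []|].
    by case: e => e; [constructor 3|constructor 4].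
  apply: (joined_trans _ _ (pt x0 0 z0)); first exact: joined_y.
  apply: base; have := down 1; rewrite mul1r sub0r subrr; apply.
  by rewrite ler01 lexx.
move=> hB; have [h0 h1 h2 [h3 h4] act] :=
  (boundary_half_solid_frame x y z).1 hB.
have [y0|yact|zact|zact] := act.
- by rewrite y0 in hB *; exact: base.
(* w = f(x) is the largest z over (x, y); it is attained on a face parallel
   to y. *)
- pose w := Num.min (3 + x) (5 - x).
  have zw := le_trans (normr_ge0 z).
  have w0 : 0 <= w by rewrite le_min !zw.
  have [wx wx'] : w <= 3 + x /\ w <= 5 - x by rewrite /w !ge_min !lexx orbT.
  have zle : `|z| <= w by rewrite le_min h3 h4.
  have out t : 0 <= t <= 1 -> boundary half_solid (pt x y (z + t * (w - z))).
    move=> /andP[t0 t1]; apply/boundary_half_solid_frame.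
    have : `|z + t * (w - z)| <= w.
      by move: zle; rewrite !ler_norml => /andP[? ?]; apply/andP; split; nra.
    by move=> ?; split; [lra..|split; lra|constructor 2].
  apply: (joined_trans _ _ (pt x y w)); first exact: joined_z.
  apply: side.
    by have := out 1; rewrite mul1r addrC subrK; apply; rewrite ler01 lexx.
  rewrite ger0_norm// /w /Num.min; by case: ifP; [left|right].
- by apply: side => //; left.
- by apply: side => //; right.
Qed.

Lemma card_faces_half_solid : ([set F | face half_solid F] #= `I_7)%card.
Proof.
(* one relative interior point of each face, in the order of half_ineq *)
pose q (i : 'I_7) : 'rV[R]_3 :=
  let: (x, y, z) := nth (0, 0, 0)
    [:: (0, 0, 0); (1, 2, 0); (-2, 3, 0); (-1, 1, 2); (2, 2^-1, 3);
        (-1, 1, -2); (2, 2^-1, -3)] i in pt x y z.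
apply: (card_faces_hpoly _ _ _ q half_normal_neq0) => [i|i j ij].
  by case: i => [[|[|[|[|[|[|[|//]]]]]]] i7]; apply/half_eqP;
    rewrite /half_ineq /=; lra.
rewrite /q; case: i j ij => [[|[|[|[|[|[|[|//]]]]]]] i7]
  [[|[|[|[|[|[|[|//]]]]]]] j7] //= _.
all: by rewrite half_ltP /half_ineq /=; lra.
Qed.

Lemma half_solid_interior_gt0 x y z :
  half_solid° (pt x y z) -> 0 < y.
Proof.
move=> /(interior_halfspace _ _ _ _ (half_normal_neq0 0)) =>
  /(_ (half_bound 0)).
by rewrite half_ltP /half_ineq /= => /(_ (fun p hp => hp 0)); lra.
Qed.

Lemma half_solid_interior_nonempty : half_solid° !=set0.
Proof.
exists (pt 0 1 0); apply: hpoly_strict_interior => i; rewrite half_ltP.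
by case: i => [[|[|[|[|[|[|[|//]]]]]]] i7]; rewrite /half_ineq /=; lra.
Qed.

(** The sections at [x = -3, -1, 1, 3], where [f(x)] or [f(-x)] changes its
slope or vanishes; there [f(-x)] is 2, 4, 2, 0 and [f(x)] is 0, 2, 4, 2.  Each
section contributes the four corners of its rectangle.  Some of them coincide
or lie inside an edge. *)
Definition half_vertex (i : 'I_4 * bool * bool) : 'rV[R]_3 :=
  let: (k, b, c) := i in
  pt (k%:R *+ 2 - 3) ([:: 2; 4; 2; 0]`_k *+ b)
     ((-1) ^+ c * [:: 0; 2; 4; 2]`_k).

(** Between two consecutive sections both [f(x)] and [f(-x)] are affine.  So a
point whose y and z are fixed proportions [u] and [1 - 2 * v] of [f(-x)] and
[f(x)] lies on the segment that joins the points with the same proportions in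
the two sections. *)
Lemma half_solid_convex_hull : half_solid = convex_hull (range half_vertex).
Proof.
apply/seteqP; split; last first.
  apply: convex_hull_min; first exact: hpoly_convex.
  move=> _ [[[k b] c] _ <-]; apply/half_solid_frame.
  rewrite normrM normrX normrN1 expr1n mul1r.
  by case: k => [[|[|[|[|//]]]] k4] /=; rewrite ?ger0_norm //; case: b;
    rewrite ?mulr1n ?mulr0n; split; lra.
have hC := convex_hull_convex (range half_vertex).
have /convex_setP cC := hC.
set C := convex_hull _ in hC cC *.
have slice (k : 'I_4) u v : 0 <= u <= 1 -> 0 <= v <= 1 ->
    C (pt (k%:R *+ 2 - 3) (u * [:: 2; 4; 2; 0]`_k) ((1 - 2 * v) * [:: 0; 2; 4;
      2]`_k)).
  move=> u01 v01.
  have corner b c : C (half_vertex (k, b, c)) by apply: sub_convex_hull;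
    exists (k, b, c).
  have row c := cC _ _ u u01 (corner false c) (corner true c).
  have := cC _ _ v v01 (row false) (row true).
  rewrite /= !frame_conv; congr (C (pt _ _ _));
    rewrite ?mulr1n ?mulr0n ?expr0 ?expr1; ring.
have sweep (k : 'I_3) t u v : 0 <= t <= 1 -> 0 <= u <= 1 -> 0 <= v <= 1 ->
    C (pt (k%:R *+ 2 - 3 + 2 * t)
       (u * ((1 - t) * [:: 2; 4; 2]`_k + t * [:: 4; 2; 0]`_k))
       ((1 - 2 * v) * ((1 - t) * [:: 0; 2; 4]`_k + t * [:: 2; 4; 2]`_k))).
  move=> t01 u01 v01.
  have := cC _ _ t t01 (slice (widen_ord (leqnSn 3) k) u v u01 v01)
                       (slice (lift ord0 k) u v u01 v01).
  rewrite frame_conv; congr (C (pt _ _ _)).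
  - by rewrite lift0 /= -natr1; ring.
  - by case: k => [[|[|[|//]]] k3] /=; ring.
  - by case: k => [[|[|[|//]]] k3] /=; ring.
(* At x = -3 and x = 3 a section is degenerate, and the proportion of zero to
   zero is chosen to be 0. *)
have ratio (y h : R) : 0 <= y <= h -> exists2 u, 0 <= u <= 1 & y = u * h.
  move=> /andP[y0 yh]; have [h0|h0] := eqVneq h 0.
    by exists 0; rewrite ?lexx ?ler01// mul0r; lra.
  exists (y / h); last by rewrite divfK.
  have hp : 0 < h by lra.
  by rewrite divr_ge0 ?ler_pdivrMr ?mul1r //; lra.
have fill (k : 'I_3) t y z : 0 <= t <= 1 ->
    0 <= y <= (1 - t) * [:: 2; 4; 2]`_k + t * [:: 4; 2; 0]`_k ->
    `|z| <= (1 - t) * [:: 0; 2; 4]`_k + t * [:: 2; 4; 2]`_k ->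
    C (pt (k%:R *+ 2 - 3 + 2 * t) y z).
  move=> t01 /ratio[u u01 ->]; set f := (X in _ <= X) => zf.
  have [|v v01 e] := ratio (f - z) (2 * f).
    by move: zf; rewrite ler_norml; lra.
  have -> : z = (1 - 2 * v) * f by lra.
  exact: sweep.
move=> p; have [x [y [z ->]]] := frame_surj p.
move=> /half_solid_frame[h0 h1 h2 [h3 h4]].
have zz := normr_ge0 z.
have [x1|x1] := leP x (-1).
  rewrite (_ : x = 0%:R *+ 2 - 3 + 2 * ((x + 3) / 2)); last by field.
  by apply: (fill 0) => /=; lra.
have [x2|x2] := leP x 1.
  rewrite (_ : x = 1%:R *+ 2 - 3 + 2 * ((x + 1) / 2)); last by field.
  by apply: (fill 1) => /=; lra.
rewrite (_ : x = 2%:R *+ 2 - 3 + 2 * ((x - 1) / 2)); last by field.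
by apply: (fill 2) => /=; lra.
Qed.

Lemma convex_polytope_half_solid : convex_polytope half_solid.
Proof.
split; first exact: half_solid_interior_nonempty.
exists (range half_vertex); split; last exact: half_solid_convex_hull.
by apply: finite_image; exact: finite_finset.
Qed.

End Frame.

(** * Truncation in barycentric coordinates *)

Section Barycentric.
Context {R : realType}.
Variables (v u : 'I_4 -> 'rV[R]_3) (b : 'I_4 -> R).

Local Notation bary i x := (dot (u i) x + b i).

Hypothesis bary_vertex : forall i j, bary i (v j) = (i == j)%:R.
Hypothesis bary_sum1 : forall x, \sum_i bary i x = 1.
Hypothesis bary_comb : forall x, \sum_i bary i x *: v i = x.

Lemma bary_conv i t x y :
  bary i ((1 - t) *: x + t *: y) = (1 - t) * bary i x + t * bary i y.
Proof. by rewrite dotDr !dotZr; ring. Qed.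

Lemma simplex_bary : convex_hull (range v) = [set x | forall i, 0 <= bary i x].
Proof.
apply/seteqP; split.
  apply: convex_hull_min.
    apply/convex_setP => x y t /andP[t0 t1] hx hy i; rewrite bary_conv.
    by have := hx i; have := hy i; nra.
  by move=> _ [j _ <-] i; rewrite bary_vertex ler0n.
move=> x hx; rewrite -(bary_comb x).
apply: convex_sum => //; first exact: convex_hull_convex.
by move=> i; apply: sub_convex_hull; exists i.
Qed.

(** The points that span the corner are the vertex [v i] and, on each edge from
it, the point with [i]-th coordinate 2/3.  Relative to this smaller simplex
[x] has barycentric coordinates [m j = 3 * bary j x - 2 * (j == i)]. *)
Lemma corner_bary i :
  corner v i = [set x | (forall j, 0 <= bary j x) /\ 2 / 3 <= bary i x].
Proof.
apply/seteqP; split.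
  apply: convex_hull_min.
    apply/convex_setP => x y t /andP[t0 t1] [hx xi] [hy yi]; split=> [j|].
      by rewrite bary_conv; have := hx j; have := hy j; nra.
    by rewrite bary_conv; nra.
  move=> _ [j _ <-].
  have cE k : bary k (v i + 3^-1 *: (v j - v i)) =
      2 / 3 * (k == i)%:R + 3^-1 * (k == j)%:R.
    by rewrite -!bary_vertex dotDr dotZr dotBr; field.
  split=> [k|]; first by rewrite cE addr_ge0// mulr_ge0// divr_ge0.
  by rewrite cE eqxx mulr1 lerDl mulr_ge0.
move=> x [hx xi].
pose m j := 3 * bary j x - 2 * (j == i)%:R.
have m1 : \sum_j m j = 1.
  rewrite sumrB -mulr_sumr bary_sum1 -mulr_sumr (bigD1 i)//= eqxx big1 =>
    [|j /negPf->//].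
  by rewrite mulr1n; ring.
have -> : x = \sum_j m j *: (v i + 3^-1 *: (v j - v i)).
  transitivity (\sum_j (m j *: (2 / 3 *: v i) + 3^-1 *: (m j *: v j)));
    last first.
    by apply: eq_bigr => j _; apply/rowP => k; rewrite !mxE; field.
  rewrite big_split /= -scaler_suml m1 scale1r -scaler_sumr.
  under eq_bigr do rewrite scalerBl -scalerA.
  rewrite sumrB -scaler_sumr bary_comb (bigD1 i)//= eqxx big1 => [|j /negPf->];
    last first.
    by rewrite mulr0 scale0r.
  by apply/rowP => k; rewrite !mxE mulr1n; field.
apply: convex_sum => //; first exact: convex_hull_convex.
  by move=> j; apply: sub_convex_hull; exists j.
move=> j; rewrite /m; have [->|_] := eqVneq j i; first by rewrite mulr1n; lra.
by rewrite mulr0n; have := hx j; lra.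
Qed.

(** Removing the corners leaves the points with all coordinates below 2/3.  A
point with some coordinate equal to 2/3 is a limit of such points: move it
towards the centroid [o], whose coordinates are 1/4. *)
Lemma truncation_bary :
  closure (convex_hull (range v) `\` \bigcup_i corner v i) =
  [set x | forall i, 0 <= bary i x <= 2 / 3].
Proof.
apply/seteqP; split.
  have -> : [set x | forall i, 0 <= bary i x <= 2 / 3] =
      hpoly (fun i => -1 *: u i) b `&` hpoly u (fun i => 2 / 3 - b i).
    apply/seteqP; split=> x.
      by move=> hx; split=> i; have := hx i; rewrite ?dotZl; lra.
    by move=> [h1 h2] i; have := h1 i; have := h2 i; rewrite dotZl; lra.
  set slab := _ `&` _; have /closure_id -> : closed slab.
    by apply: closedI; exact: closed_hpoly.
  apply: closureS => x [+ hN]; rewrite simplex_bary => hx.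
  split=> i; first by rewrite dotZl; have := hx i; lra.
  rewrite leNgt; apply/negP => xi; apply: hN; exists i => //.
  by rewrite corner_bary; split=> //; lra.
move=> x hx B /=; rewrite -/(interior B x) => Bx.
pose o := 4^-1 *: \sum_i v i.
have o4 i : bary i o = 4^-1.
  have vi j : dot (u i) (v j) = (i == j)%:R - b i by rewrite -bary_vertex addrK.
  rewrite dotZr !big_ord_recl big_ord0 !dotDr !vi -(scale0r 0) dotZr.
  by case: i {vi} => [[|[|[|[|//]]]] i4] /=; field.
have [e e01 /(_ 0) Be] := interior_along _ _ 1 (fun=> o - x) Bx.
exists (x + e *: (o - x)); split=> //.
have eE i : bary i (x + e *: (o - x)) = (1 - e) * bary i x + e * 4^-1.
  by rewrite -(o4 i) -bary_conv; congr (dot _ _ + _); apply/rowP => k;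
    rewrite !mxE; ring.
split.
  by rewrite simplex_bary => i; rewrite eE; have := hx i; nra.
move=> [i _]; rewrite corner_bary => -[_]; rewrite eE; have := hx i; nra.
Qed.

End Barycentric.

(** * Rotating a regular tetrahedron *)

Section Rotation.
Context {R : realType}.

Lemma dist_sqr (x y : 'rV[R]_3) :
  dist x y ^+ 2 = dot x x - 2 * dot x y + dot y y.
Proof.
rewrite sqr_sqrtr; first by rewrite dotBr !(dotC (_ - _)) !dotBr (dotC y x);
  ring.
by apply: sumr_ge0 => k _; rewrite -expr2 sqr_ge0.
Qed.

(** The matrix with columns [e k] is orthogonal with determinant [eps], which
is 1 or -1; multiplying its middle column by [eps] makes it a rotation. *)
Lemma orthonormal_rotation (e : 'I_3 -> 'rV[R]_3) :
    (forall i j, dot (e i) (e j) = (i == j)%:R) ->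
  exists (M : 'M[R]_3) (eps : R), [/\ rotation M, eps != 0 &
    forall x, x *m M = row3 (dot x (e 0)) (eps * dot x (e 1)) (dot x (e 2))].
Proof.
move=> ee; pose M0 : 'M[R]_3 := \matrix_(i, k) e k 0 i.
have M0K : M0 *m M0^T = 1%:M.
  apply: mulmx1C; apply/matrixP => i j; rewrite !mxE -ee.
  by apply: eq_bigr => k _; rewrite !mxE.
pose eps := \det M0.
have eps2 : eps * eps = 1.
  by have := congr1 determinant M0K; rewrite det_mulmx det_tr det1.
pose D := diag_mx (row3 1 eps 1).
have DD : D *m D = 1%:M.
  apply/matrixP => i j; rewrite mul_diag_mx !mxE.
  by case: i => [[|[|[|//]]] i3]; case: j => [[|[|[|//]]] j3] //=;
    rewrite ?mulr1n ?mulr0n ?mulr0 ?mulr1.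
exists (M0 *m D), eps; split.
- split; first by rewrite trmx_mul tr_diag_mx mulmxA -(mulmxA M0) DD mulmx1.
  by rewrite det_mulmx det_diag !big_ord_recl big_ord0 !mxE /= mul1r !mulr1.
- by apply/eqP => e0; move/eqP: eps2; rewrite e0 mul0r eq_sym oner_eq0.
- move=> x; rewrite mulmxA mul_mx_diag; apply/rowP => j; rewrite !mxE.
  have xE k : \sum_l x 0 l * M0 l k = dot x (e k) by apply: eq_bigr => l _;
    rewrite mxE.
  rewrite xE; case: j => [[|[|[|//]]] j3] /=.
  + by rewrite mulr1; congr (dot _ (e _)); apply: val_inj.
  + by rewrite mulrC; congr (_ * dot _ (e _)); apply: val_inj.
  + by rewrite mulr1; congr (dot _ (e _)); apply: val_inj.
Qed.

Definition std_vertex (i : 'I_4) : R * R * R :=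
  nth (0, 0, 0) [:: (3, 0, 6); (3, 0, -6); (-3, 6, 0); (-3, -6, 0)] i.

(** The edge vectors [v 0 - v 1] and [v 2 - v 3] and the vector [w0] between
the sums of their endpoints are pairwise orthogonal, of norms [a], [a] and
[a * sqrt 2]: their Gram matrix is determined by the six distances. *)
Lemma regular_tetrahedron_frame (v : 'I_4 -> 'rV[R]_3) :
  regular_tetrahedron v ->
  exists (M : 'M[R]_3) (g s : 'rV[R]_3), [/\ rotation M, forall k, s 0 k != 0 &
    forall i, v i *m M = let: (x, y, z) := std_vertex i in frame g s x y z].
Proof.
move=> [a [a0 va]].
have vv i j : i != j -> dot (v i) (v i) - 2 * dot (v i) (v j) + dot (v j) (v j)
  = a ^+ 2.
  by move=> ij; rewrite -dist_sqr va.
have := vv 0 1 isT; have := vv 0 2 isT; have := vv 0 3 isT.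
have := vv 1 2 isT; have := vv 1 3 isT; have := vv 2 3 isT.
move=> v23 v13 v12 v03 v02 v01.
pose w0 := v 0 + v 1 - (v 2 + v 3); pose w1 := v 2 - v 3; pose w2 := v 0 - v 1.
have dE := (@dotDl R, @dotDr R, @dotNl R, @dotNr R).
have sw := (dotC (v 1) (v 0), dotC (v 2) (v 0), dotC (v 3) (v 0)).
have sw' := (dotC (v 2) (v 1), dotC (v 3) (v 1), dotC (v 3) (v 2)).
move: sw sw' => [[s10 s20] s30] [[s21 s31] s32].
have w00 : dot w0 w0 = 2 * a ^+ 2 by rewrite /w0 /w1 /w2 !dE; lra.
have w11 : dot w1 w1 = a ^+ 2 by rewrite /w0 /w1 /w2 !dE; lra.
have w22 : dot w2 w2 = a ^+ 2 by rewrite /w0 /w1 /w2 !dE; lra.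
have w01 : dot w0 w1 = 0 by rewrite /w0 /w1 /w2 !dE; lra.
have w02 : dot w0 w2 = 0 by rewrite /w0 /w1 /w2 !dE; lra.
have w12 : dot w1 w2 = 0 by rewrite /w0 /w1 /w2 !dE; lra.
pose r : R := Num.sqrt 2.
have r0 : r != 0 by rewrite gt_eqF// sqrtr_gt0.
have r2 : r ^+ 2 = 2 by rewrite sqr_sqrtr.
have aN0 : a != 0 by rewrite gt_eqF.
pose e (k : 'I_3) := nth 0 [:: (a * r)^-1 *: w0; a^-1 *: w1; a^-1 *: w2] k.
have [|M [eps [rotM eps0 xM]]] := orthonormal_rotation e.
  have nE := (@dotZl R, @dotZr R, w00, w11, w22, w01, w02, w12,
    dotC w1 w0, dotC w2 w0, dotC w2 w1, mulr0).
  case=> [[|[|[|//]]] i3] [[|[|[|//]]] j3]; rewrite /e /= !nE //.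
  - by rewrite -r2; field; rewrite r0 aN0.
  - by field.
  - by field.
exists M, (4^-1 *: ((v 0 + v 1 + (v 2 + v 3)) *m M)),
  (row3 (a * r / 12) (eps * a / 12) (a / 12)); split=> //.
  case=> [[|[|[|//]]] k3]; rewrite mxE /= !mulf_neq0 ?invr_eq0//; by lra.
have W0 : w0 *m M = row3 (a * r) 0 0.
  rewrite xM /e /= !dotZr w00 w01 w02 !mulr0 -r2; congr (row3 _ _ _).
  by field; rewrite r0 aN0.
have W1 : w1 *m M = row3 0 (eps * a) 0.
  rewrite xM /e /= !dotZr (dotC w1 w0) w01 w11 w12 !mulr0; congr (row3 _ _ _).
  by field.
have W2 : w2 *m M = row3 0 0 a.
  rewrite xM /e /= !dotZr (dotC w2) w02 (dotC w2) w12 w22 !mulr0;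
    congr (row3 _ _ _).
  by field.
(* Each vertex is the centroid plus multiples A, B, C of w0, w1, w2. *)
have vE i A B C : v i = 4^-1 *: (v 0 + v 1 + (v 2 + v 3)) + A *: w0 + B *: w1 +
  C *: w2 ->
    v i *m M = 4^-1 *: ((v 0 + v 1 + (v 2 + v 3)) *m M) +
      row3 (A * (a * r)) (B * (eps * a)) (C * a).
  move=> ->; rewrite 3!mulmxDl -!scalemxAl W0 W1 W2 -!addrA; congr (_ + _).
  by apply/rowP => -[[|[|[|//]]] k3]; rewrite !mxE /=; ring.
have sE x y z : row3 (row3 (a * r / 12) (eps * a / 12) (a / 12) 0 0 * x)
    (row3 (a * r / 12) (eps * a / 12) (a / 12) 0 1 * y)
    (row3 (a * r / 12) (eps * a / 12) (a / 12) 0 2 * z) =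
    row3 (x / 12 * (a * r)) (y / 12 * (eps * a)) (z / 12 * a).
  by rewrite !mxE /=; congr (row3 _ _ _); ring.
have ordE (i : 'I_4) : [\/ i = 0, i = 1, i = 2 | i = 3].
  by case: i => [[|[|[|[|//]]]] i4];
    [constructor 1|constructor 2|constructor 3|constructor 4]; apply: val_inj.
by move=> i; case: (ordE i) => ->; rewrite /std_vertex /= /frame sE; apply: vE;
  apply/rowP => k; rewrite !mxE; field.
Qed.

End Rotation.

(** * The truncated tetrahedron and its halves *)

Section Assembly.
Context {R : realType}.
Implicit Types (g s : 'rV[R]_3).

(** The barycentric coordinates of the standard tetrahedron are
[(3 + x + z) / 12], [(3 + x - z) / 12], [(3 - x + y) / 12] and
[(3 - x - y) / 12].  Bounding them by 0 and 2/3 gives eight inequalities, two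
for each of the four absolute values below. *)
Lemma truncation_frame (v : 'I_4 -> 'rV[R]_3) (M : 'M[R]_3) g s :
    rotation M -> (forall k, s 0 k != 0) ->
    (forall i, v i *m M = let: (x, y, z) := std_vertex i in frame g s x y z) ->
  forall x y z,
    [set p *m M | p in closure (convex_hull (range v) `\` \bigcup_i corner v i)]
      (frame g s x y z) <->
    [/\ `|y| <= 3 - x, `|y| <= 5 + x, `|z| <= 3 + x & `|z| <= 5 - x].
Proof.
move=> [MMT _] s0 vM.
pose dir (i : 'I_4) : R * R * R :=
  nth (0, 0, 0) [:: (1, 0, 1); (1, 0, -1); (-1, 1, 0); (-1, -1, 0)] i.
pose n i := let: (a, b, c) := dir i in covector s (a / 12) (b / 12) (c / 12).
pose u i := n i *m M^T.
pose b i := 4^-1 - dot (n i) g.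
have uE i p : dot (u i) p = dot (n i) (p *m M).
  by rewrite !dot_mulmx /u trmx_mul mulmxA.
have baryE i p x y z : p *m M = frame g s x y z ->
    dot (u i) p + b i = let: (c0, c1, c2) :=
      dir i in (3 + c0 * x + c1 * y + c2 * z) / 12.
  move=> pM; rewrite uE pM /b /n; case: (dir i) => [[c0 c1] c2].
  by rewrite dot_covector//; field.
rewrite (truncation_bary _ u b); first last.
- move=> p; rewrite -[LHS]mulmx1 -[RHS]mulmx1 -MMT !mulmxA; congr (_ *m _).
  have [x [y [z pM]]] := frame_surj g s s0 (p *m M).
  rewrite mulmx_suml; under eq_bigr do rewrite -scalemxAl vM (baryE _ _ _ _ _
    pM).
  rewrite !big_ord_recl big_ord0 pM /dir /std_vertex /=.
  by apply/rowP => -[[|[|[|//]]] k3]; rewrite !mxE /=; field.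
- move=> p; have [x [y [z pM]]] := frame_surj g s s0 (p *m M).
  under eq_bigr do rewrite (baryE _ _ _ _ _ pM).
  by rewrite !big_ord_recl big_ord0 /dir /=; field.
- move=> i j; have := vM j; case E: (std_vertex j) => [[x y] z] /baryE ->.
  by case: i j E => [[|[|[|[|//]]]] i4] [[|[|[|[|//]]]] j4] [<- <- <-];
    rewrite /dir /=; field.
move=> x y z; split.
  move=> [p hp pM]; rewrite !ler_norml.
  have hi k (k4 : (k < 4)%N) := hp (Ordinal k4).
  have := hi 0 isT; have := hi 1 isT; have := hi 2 isT; have := hi 3 isT.
  rewrite !(baryE _ _ _ _ _ pM) /dir /=.
  move=> /andP[? ?] /andP[? ?] /andP[? ?] /andP[? ?].
  by split; apply/andP; split; lra.
have M'M : M^T *m M = 1%:M by exact: mulmx1C.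
rewrite !ler_norml => -[/andP[? ?] /andP[? ?] /andP[? ?] /andP[? ?]].
have pM : frame g s x y z *m M^T *m M = frame g s x y z
  by rewrite -mulmxA M'M mulmx1.
exists (frame g s x y z *m M^T) => // i; rewrite (baryE _ _ _ _ _ pM) /dir.
by case: i => [[|[|[|[|//]]]] i4] /=; apply/andP; split; lra.
Qed.

Definition mirror s : 'rV[R]_3 := row3 (s 0 0) (- s 0 1) (s 0 2).

Lemma mirror_neq0 s : (forall k, s 0 k != 0) -> forall k, mirror s 0 k != 0.
Proof.
move=> s0 -[[|[|[|//]]] k3]; rewrite mxE /= ?oppr_eq0; exact: s0.
Qed.

Lemma frame_mirror g s x y z : frame g s x y z = frame g (mirror s) x (- y) z.
Proof. by rewrite /frame !mxE /= mulrNN. Qed.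

End Assembly.

Theorem theorem5p8 (R : realType) (T : set 'rV[R]_3)
    (hT : truncated_tetrahedron T) :
  exists M : 'M[R]_3, rotation M /\
    exists P : 'I_2 -> set 'rV[R]_3,
      decomposed [set x *m M | x in T] P /\
      forall i, heptahedron (P i) /\ orthogonally_connected (boundary (P i)).
Proof.
have [v [/regular_tetrahedron_frame[M [g [s [rotM s0 vM]]]] ->]] := hT.
exists M; split=> //.
have s'0 := mirror_neq0 _ s0.
pose side (i : 'I_2) := if i == 0 then s else mirror s.
have side0 i : forall k, side i 0 k != 0 by rewrite /side; case: ifP.
exists (fun i => half_solid g (side i)); split; last first.
  move=> i; split; last exact: orthogonally_connected_half_solid.
  by split; [exact: convex_polytope_half_solid|exact: card_faces_half_solid].
split=> [i||].
- exact: convex_polytope_half_solid.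
- apply/seteqP; split=> p; have [x [y [z ->]]] := frame_surj g s s0 p.
    move=> /(truncation_frame _ _ _ _ rotM s0 vM)[y1 y2 z1 z2].
    have [y0|y0] := leP 0 y.
      exists 0 => //; apply/half_solid_frame; first exact: side0.
      by move: y1 y2; rewrite ger0_norm//; split.
    exists 1 => //; rewrite frame_mirror; apply/half_solid_frame;
      first exact: s'0.
    by move: y1 y2; rewrite ltr0_norm// => ? ?; split=> //; lra.
  move=> [i _ hi]; apply/(truncation_frame _ _ _ _ rotM s0 vM).
  move: hi; rewrite /side; case: ifP => _.
    by move=> /(half_solid_frame _ _ s0)[y0 y1 y2 [z1 z2]]; rewrite ger0_norm.
  rewrite frame_mirror => /(half_solid_frame _ _ s'0)[y0 y1 y2 [z1 z2]].
  by rewrite ler0_norm//; lra.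
have apart p : (half_solid g s)° p -> (half_solid g (mirror s))° p -> False.
  have [x [y [z ->]]] := frame_surj g s s0 p.
  move=> /(half_solid_interior_gt0 _ _ s0) y0; rewrite frame_mirror =>
    /(half_solid_interior_gt0 _ _ s'0); lra.
have ord2 (i : 'I_2) : i = 0 \/ i = 1.
  by case: i => [[|[|//]] i2]; [left|right]; apply: val_inj.
move=> i j _ _ [p [pi pj]]; move: pi pj.
by case: (ord2 i) => ->; case: (ord2 j) => -> //= pi pj; case: (apart p).
Qed.
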